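(* For every nonnegative integer $n$, the number of words $w = w_1 w_2 \cdots w_{5n}$ of length $5n$ over the alphabet $\{3,-2\}$ (each letter $w_k \in \{3,-2\}$) such that (i) $\sum_{k=1}^{5n} w_k = 0$, and (ii) there are no indices $1 \le i \le j < 5n$ with $w_i = 3$, $\sum_{k=i}^{j} w_k = 0$, and $w_{j+1} = -2$, is exactly $10^n$.
   Context: A factor of a word is a contiguous subword $w_i w_{i+1}\cdots w_j$. Condition (ii) says: no factor that sums to $0$ and begins with the letter $3$ is immediately followed by the letter $-2$. *)

(* Defs.v *)
From HB Require Import structures.
From mathcomp Require Import all_boot all_order all_algebra.
Set Implicit Arguments.
Unset Strict Implicit.
Unset Printing Implicit Defensive.
Import Order.TTheory GRing.Theory Num.Theory.
Local Open Scope ring_scope.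

Definition letter : finType := @seq_sub int [:: 3; - 2].

(* Positions are 0-based: [wt w k] is the integer w_{k+1}. *)
Definition wt (m : nat) (w : m.-tuple letter) (k : 'I_m) : int :=
  val (tnth w k).

Definition word_sum (m : nat) (w : m.-tuple letter) : int := \sum_(k < m) wt w k.

Definition factor_sum (m : nat) (w : m.-tuple letter) (i j : 'I_m) : int :=
  \sum_(k < m | (i <= k <= j)%N) wt w k.

(* The position [l] is the one immediately after [j]; requiring it to be an
   element of ['I_m] is the constraint that the factor is not a suffix. *)
Definition has_bad_factor (m : nat) (w : m.-tuple letter) : bool :=
  [exists i : 'I_m, exists j : 'I_m, exists l : 'I_m,
    [&& (i <= j)%N, l == j.+1 :> nat, wt w i == 3,
        factor_sum w i j == 0 & wt w l == - 2]].

(* Main.v *)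
(**
Encode a word by booleans, [true] for the letter 3, and let its height at time t
be the sum of its first t letters. Condition (ii) says that at every height all
exits by -2 precede all exits by 3.

Fix a 5-periodic pattern P with two letters 3 per period; there are 10 of them.
For a word f of length 5n with sum 0, let the excess M(t) be the number of
letters 3 among the first t letters of f minus the same number for P. It has
steps -1, 0, 1 and M(0) = M(5n) = 0. Heights are congruent to 3t modulo 5, so
the loop P[p, p+5) inserted into f at time p meets exactly the heights that f
visits at the times t with M(t) = M(p). Hence the insertion preserves (ii) if no
step of M before p goes up from the level M(p) and no step after p goes down from
it, in particular if p is the first time at which M is minimal. Conversely, the
first zero-sum window of length 5 of a valid word is such a loop, and a valid
word contains only one, because excesses relative to two patterns differ by a
5-periodic function. So (word, pattern) -> extended word is a bijection, and each
five letters contribute a factor 10.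
*)
Require Import Defs.
From mathcomp Require Import all_boot all_order all_algebra.
From mathcomp Require Import zify.
Local Open Scope ring_scope.

Set Implicit Arguments.
Unset Strict Implicit.
Unset Printing Implicit Defensive.

Import Order.TTheory GRing.Theory Num.Theory.

(** * Boolean words, heights and excess over a periodic pattern *)

Definition ups (f : nat -> bool) (t : nat) : nat := (\sum_(i < t) f i)%N.

Definition balanced (f : nat -> bool) (N : nat) : Prop :=
  (5 * ups f N = 2 * N)%N.

(* The height at time t is [5 * ups f t - 2 * t]; the equation says that the
   heights at [i] and [j] agree, without subtraction. *)
Definition exit_sorted (f : nat -> bool) (N : nat) : Prop :=
  forall i j, (i < j)%N -> (j < N)%N ->
    (5 * ups f i + 2 * j = 5 * ups f j + 2 * i)%N -> f i -> f j.

Definition pattern (P : nat -> bool) : Prop :=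
  (forall t, P (t + 5)%N = P t) /\ ups P 5 = 2%N.

Definition excess (f P : nat -> bool) (t : nat) : int :=
  (ups f t)%:Z - (ups P t)%:Z.

Definition first_min (f P : nat -> bool) (N p : nat) : Prop :=
  [/\ (p <= N)%N,
      forall t, (t < p)%N -> excess f P p < excess f P t &
      forall t, (t <= N)%N -> excess f P p <= excess f P t].

(** The loop reads [P] at absolute times, so the excess is constant along it, and the letters of [f]
    moved by a whole period still face the same letters of [P]. *)
Definition insert (p : nat) (P f : nat -> bool) (t : nat) : bool :=
  if (t < p)%N then f t else if (t < p + 5)%N then P t else f (t - 5)%N.

Definition remove (q : nat) (g : nat -> bool) (t : nat) : bool :=
  if (t < q)%N then g t else g (t + 5)%N.

Lemma upsS f t : ups f t.+1 = (ups f t + f t)%N.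
Proof. by rewrite /ups big_ord_recr. Qed.

Lemma ups0 f : ups f 0 = 0%N.
Proof. by rewrite /ups big_ord0. Qed.

Lemma eq_ups f g t : (forall s, (s < t)%N -> f s = g s) -> ups f t = ups g t.
Proof. by move=> fg; apply: eq_bigr => i _; rewrite fg. Qed.

Lemma ups_periodic P t : (forall t, P (t + 5)%N = P t) ->
  ups P (t + 5) = (ups P t + ups P 5)%N.
Proof.
move=> Pper; elim: t => [|t IHt]; first by rewrite ups0.
by rewrite addSn (upsS P (t + 5)) (upsS P t) IHt Pper; lia.
Qed.

Lemma ups_pattern P t : pattern P -> ups P (t + 5) = (ups P t + 2)%N.
Proof. by case=> Pper P2; rewrite ups_periodic // P2. Qed.

Lemma ups_patternM P t k : pattern P -> ups P (t + 5 * k) = (ups P t + 2 * k)%N.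
Proof.
move=> Ppat; elim: k => [|k IHk]; first by rewrite muln0 !addn0.
by rewrite mulnS addnCA addnC ups_pattern // IHk; lia.
Qed.

Lemma periodM P t k : pattern P -> P (t + 5 * k)%N = P t.
Proof.
case=> Pper _; elim: k => [|k IHk]; first by rewrite muln0 addn0.
by rewrite mulnS addnCA addnC Pper.
Qed.

Lemma period_modn P s t : pattern P -> s = t %[mod 5] -> P s = P t.
Proof.
move=> Ppat st; have red u : P u = P (u %% 5)%N.
  by rewrite -(periodM (u %% 5) (u %/ 5) Ppat); congr P; lia.
by rewrite red st -red.
Qed.

Lemma excessS f P t :
  excess f P t.+1 = excess f P t + (f t)%:Z - (P t)%:Z.
Proof. by rewrite /excess !upsS; lia. Qed.

(* Times at the same height are congruent modulo 5, since both steps are 3 modulo 5. *)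
Lemma same_height f P i j : pattern P -> (i < j)%N ->
  (5 * ups f i + 2 * j = 5 * ups f j + 2 * i)%N ->
  excess f P i = excess f P j /\ P i = P j.
Proof.
move=> Ppat lt_ij eq_h.
have [k jE] : exists k, j = (i + 5 * k)%N.
  by exists ((j - i) %/ 5)%N; lia.
subst j; rewrite /excess (ups_patternM _ _ Ppat) (periodM i k Ppat); split => //; lia.
Qed.

Lemma excess_eq_height f P i j : pattern P -> (i <= j)%N ->
  i = j %[mod 5] -> excess f P i = excess f P j ->
  (5 * ups f i + 2 * j = 5 * ups f j + 2 * i)%N.
Proof.
move=> Ppat le_ij eq_m; have [k jE] : exists k, j = (i + 5 * k)%N.
  by exists ((j - i) %/ 5)%N; lia.
by subst j; rewrite /excess (ups_patternM _ _ Ppat); lia.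
Qed.

(** * Insertion of a loop *)

Lemma insert_before p P f t : (t < p)%N -> insert p P f t = f t.
Proof. by rewrite /insert => ->. Qed.

Lemma insert_loop p P f t : (p <= t)%N -> (t < p + 5)%N -> insert p P f t = P t.
Proof. by rewrite /insert => ? ->; rewrite ltnNge; case: leqP => //; lia. Qed.

Lemma insert_after p P f t : (p <= t)%N -> insert p P f (t + 5) = f t.
Proof. by move=> ?; rewrite /insert addnK; do 2![case: ltnP => //; try lia]. Qed.

Lemma ups_insert_before p P f t : (t <= p)%N -> ups (insert p P f) t = ups f t.
Proof.
move=> le_tp; apply: eq_ups => s lt_st.
by rewrite /insert (leq_trans lt_st le_tp).
Qed.

Lemma excess_insert_before p P f t :
  (t <= p)%N -> excess (insert p P f) P t = excess f P t.
Proof. by move=> le_tp; rewrite /excess ups_insert_before. Qed.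

Lemma excess_insert_loop p P f t : (p <= t)%N -> (t <= p + 5)%N ->
  excess (insert p P f) P t = excess f P p.
Proof.
move=> /subnKC <-; rewrite leq_add2l; elim: (t - p)%N => [|k IHk] le_k5; first by rewrite addn0 excess_insert_before.
by rewrite addnS excessS IHk 1?ltnW // insert_loop ?addrK ?leq_addr ?ltn_add2l.
Qed.

Lemma excess_insert_after p P f t : pattern P ->
  (p <= t)%N -> excess (insert p P f) P (t + 5) = excess f P t.
Proof.
move=> Ppat /subnK <-; elim: (t - p)%N => [|k IHk].
  by rewrite add0n excess_insert_loop ?leq_addr.
case: (Ppat) => Pper _.
by rewrite !addSn !excessS IHk Pper insert_after ?leq_addl.
Qed.

Lemma ups_insert_after p P f t : pattern P ->
  (p <= t)%N -> ups (insert p P f) (t + 5) = (ups f t + 2)%N.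
Proof.
move=> Ppat le_pt; have := excess_insert_after f Ppat le_pt.
by rewrite /excess (ups_pattern _ Ppat); lia.
Qed.

Lemma balanced_insert p P f N : pattern P -> (p <= N)%N ->
  balanced (insert p P f) (N + 5) <-> balanced f N.
Proof. by move=> ? ?; rewrite /balanced ups_insert_after //; lia. Qed.

Variant position p : nat -> Prop :=
| Before t of (t < p)%N : position p t
| Loop t of (p <= t)%N & (t < p + 5)%N : position p t
| After t of (p <= t)%N : position p (t + 5)%N.

Lemma positionP p t : position p t.
Proof.
case: (ltnP t p) => [|le_pt]; first exact: Before.
case: (ltnP t (p + 5)) => [|le_p5t]; first exact: Loop.
have -> : t = (t - 5 + 5)%N by lia.
by apply: After; lia.
Qed.

Lemma exit_sorted_insert f P N p : pattern P -> exit_sorted f N ->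
  first_min f P N p -> exit_sorted (insert p P f) (N + 5).
Proof.
move=> Ppat fs [le_pN ltp lep] i j lt_ij lt_jN eq_h.
have [eqM eqPij] := same_height Ppat lt_ij eq_h.
case: (positionP p i) lt_ij eq_h eqM eqPij => {}i.
- move=> lt_ip; rewrite insert_before // excess_insert_before ?(ltnW lt_ip) //.
  rewrite ups_insert_before ?(ltnW lt_ip) //.
  case: (positionP p j) lt_jN => {}j.
  + move=> lt_jp _ lt_ij; rewrite ups_insert_before ?(ltnW lt_jp) // insert_before //.
    by move=> eq_h _ _ fi; apply: (fs i j) => //; lia.
  (* Every loop time carries the excess of [p], which no earlier time attains. *)
  + move=> le_pj lt_j5 _ _ _; rewrite excess_insert_loop ?(ltnW lt_j5) //.
    by move=> eM; have := ltp _ lt_ip; rewrite eM ltxx.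
  + move=> le_pj lt_jN _; rewrite ups_insert_after // insert_after //.
    by move=> eq_h _ _ fi; apply: (fs i j) => //; lia.
- move=> le_pi lt_i5; rewrite insert_loop //.
  rewrite excess_insert_loop ?(ltnW lt_i5) //.
  case: (positionP p j) lt_jN => {}j.
  + by move=> *; lia.
  + by move=> le_pj lt_j5 _ _ _ _ eP; rewrite insert_loop // eP.
  + move=> le_pj lt_jN _ _; rewrite insert_after // excess_insert_after //.
    case: (Ppat) => -> _ eM eP; rewrite eP => Pj.
    (* If [P j] holds and [f j] fails, the excess falls below its minimum at [j.+1]. *)
    have := lep j.+1; rewrite excessS Pj -eM; case: (f j) => //; lia.
- move=> le_pi; rewrite insert_after // ups_insert_after //.
  case: (positionP p j) lt_jN => {}j; try by move=> *; lia.
  move=> le_pj lt_jN lt_ij; rewrite insert_after // ups_insert_after //.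
  by move=> eq_h _ _ fi; apply: (fs i j) => //; lia.
Qed.

(** Insertion only repeats the value of the excess at [p]. One direction shows that an extended word
    carries a loop at its first minimum; the other shows that deleting the loop keeps the first
    minimum in place. *)
Lemma first_min_insert f P N p : pattern P ->
  first_min f P N p <-> (p <= N)%N /\ first_min (insert p P f) P (N + 5) p.
Proof.
move=> Ppat; rewrite /first_min excess_insert_before //; split.
  case=> le_pN ltp lep; split=> //; split; first lia.
    by move=> t lt_tp; rewrite excess_insert_before ?(ltnW lt_tp) // ltp.
  move=> t; case: (positionP p t) => {}t.
  - by move=> lt_tp _; rewrite excess_insert_before ?(ltnW lt_tp) // ltW // ltp.
  - move=> le_pt lt_t5 _; by rewrite excess_insert_loop ?(ltnW lt_t5).
  - by move=> le_pt le_tN; rewrite excess_insert_after // lep //; lia.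
case=> le_pN [_ ltp lep]; split=> //.
  by move=> t lt_tp; have := ltp t lt_tp; rewrite excess_insert_before // ltnW.
move=> t le_tN; case: (leqP t p) => [le_tp|lt_pt].
  by have := lep t; rewrite excess_insert_before //; apply; lia.
have := lep (t + 5)%N; rewrite excess_insert_after //; last lia.
by apply; lia.
Qed.

Lemma insert_remove q P g t :
  (forall t, (q <= t)%N -> (t < q + 5)%N -> g t = P t) ->
  insert q P (remove q g) t = g t.
Proof.
move=> gP; case: (positionP q t) => {}t.
- by move=> lt_tq; rewrite insert_before // /remove lt_tq.
- by move=> le_qt lt_t5; rewrite insert_loop // gP.
- by move=> le_qt; rewrite insert_after // /remove ltnNge le_qt.
Qed.

(** * Uniqueness of the loop *)

Definition loop_at (g P : nat -> bool) (N p : nat) : Prop :=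
  first_min g P N p /\ forall t, (p <= t)%N -> (t < p + 5)%N -> g t = P t.

Lemma excess_loop g P p k : (k <= 5)%N ->
  (forall t, (p <= t)%N -> (t < p + 5)%N -> g t = P t) ->
  excess g P (p + k) = excess g P p.
Proof.
elim: k => [|k IHk] le_k5 gP; first by rewrite addn0.
by rewrite addnS excessS IHk 1?ltnW // gP ?addrK ?leq_addr ?ltn_add2l.
Qed.

(* The difference of the excesses relative to two patterns is 5-periodic. *)
Lemma excess_shift g P P' t k : pattern P -> pattern P' ->
  excess g P (t + 5 * k) - excess g P t = excess g P' (t + 5 * k) - excess g P' t.
Proof. by move=> Ppat Ppat'; rewrite /excess !(ups_patternM _ _ Ppat, ups_patternM _ _ Ppat'); lia. Qed.

Lemma loop_at_leq g P P' N p q : pattern P -> pattern P' ->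
  loop_at g P N p -> loop_at g P' N q -> (p <= q)%N.
Proof.
move=> Ppat P'pat [[le_pN ltp lep] gP] [[le_qN ltq leq_q] gP'].
rewrite leqNgt; apply/negP => lt_qp.
(* For disjoint loops, go back from [p] by whole periods to a time [t] in the loop at [q]. From [t]
   to [p] the excess over [P] strictly decreases, while the excess over [P'] starts at its minimum;
   both changes are equal. *)
case: (leqP (q + 5) p) => [le_q5p|lt_pq5].
  pose k := ((p - q) %/ 5)%N; pose t := (p - 5 * k)%N.
  have pE : p = (t + 5 * k)%N by rewrite /t /k; lia.
  have tE : t = (q + (t - q))%N by rewrite /t /k; lia.
  have lt_tq : (t - q <= 5)%N by rewrite /t /k; lia.
  have lt_tp : (t < p)%N by rewrite /t /k; lia.
  have := excess_shift g t k Ppat P'pat; rewrite -pE.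
  have := leq_q p le_pN; have := ltp t lt_tp.
  have := excess_loop lt_tq gP'; rewrite -tE; lia.
(* For overlapping loops, [q + 5] lies in the loop at [p]. The excess over [P'] agrees at [q] and
   [q + 5], hence so does the excess over [P], and [q < p] already attains the minimum. *)
have := ltp q lt_qp.
have e1 := excess_loop (leqnn 5) gP'.
have : excess g P (p + (q + 5 - p)) = excess g P p by apply: excess_loop => //; lia.
have -> : (p + (q + 5 - p) = q + 5)%N by lia.
have := excess_shift g q 1 Ppat P'pat; rewrite muln1; lia.
Qed.

Lemma loop_at_inj g P P' N p q : pattern P -> pattern P' ->
  loop_at g P N p -> loop_at g P' N q -> p = q /\ P =1 P'.
Proof.
move=> Ppat P'pat lp lq; have pq : p = q.
  apply/eqP; rewrite eqn_leq (loop_at_leq Ppat P'pat lp lq).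
  by rewrite (loop_at_leq P'pat Ppat lq lp).
split=> // t; subst q; case: lp lq => [_ gP] [_ gP'].
pose s := (p + (t + 4 * p) %% 5)%N.
have st : s = t %[mod 5] by rewrite /s; lia.
rewrite -(period_modn Ppat st) -(period_modn P'pat st) -gP -?gP' // /s; lia.
Qed.

(** * Existence of the loop in a valid word *)

Lemma excess_after_loop g P N p : pattern P -> exit_sorted g N ->
  (forall t, (p <= t)%N -> (t < p + 5)%N -> g t = P t) ->
  forall t, (p <= t)%N -> (t <= N)%N -> excess g P p <= excess g P t.
Proof.
move=> Ppat gs gP t /subnKC <-; elim: (t - p)%N => [|k IHk] le_kN.
  by rewrite addn0.
case: (leqP k.+1 5) => [le_k5|lt_5k]; first by rewrite excess_loop.
have {}IHk := IHk ltac:(lia).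
rewrite addnS excessS; case: (ltrP (excess g P p) (excess g P (p + k))) => [|le_k].
  by move: (g _) (P _) => [] []; lia.
(* At the level of the loop, the loop time congruent to [p + k] has the same height. If the pattern
   goes up there, then so does [g], and sortedness forces [g] up at [p + k] too: the excess cannot
   drop. *)
have eM : excess g P (p + k %% 5) = excess g P (p + k).
  rewrite excess_loop //; lia.
have eq_m : (p + k %% 5 = p + k %[mod 5])%N by lia.
have le_pk : (p + k %% 5 <= p + k)%N by lia.
have := excess_eq_height Ppat le_pk eq_m eM; move/gs => gk.
have := gk ltac:(lia) ltac:(lia).
rewrite gP; try lia.
rewrite (period_modn Ppat eq_m); case: (P _) => [->|] //; last by lia.
by rewrite // addrK.
Qed.

Lemma ups_windows_lt g q : (forall t, (t < q)%N -> (ups g (t + 5) < ups g t + 2)%N) ->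
  forall k t, (t + 5 * k < q + 5)%N -> (ups g (t + 5 * k) <= ups g t + k)%N.
Proof.
move=> lt2; elim=> [|k IHk] t; first by rewrite muln0 !addn0.
rewrite mulnS addnCA addnC => lt_tq.
by have := lt2 (t + 5 * k)%N; have := IHk t; lia.
Qed.

Lemma ups_windows_gt g q : (forall t, (t < q)%N -> (ups g (t + 5) > ups g t + 2)%N) ->
  forall k t, (t + 5 * k < q + 5)%N -> (ups g t + 3 * k <= ups g (t + 5 * k))%N.
Proof.
move=> lt2; elim=> [|k IHk] t; first by rewrite !muln0 !addn0.
rewrite [(5 * _)%N]mulnS addnCA addnC => lt_tq.
by have := lt2 (t + 5 * k)%N; have := IHk t; lia.
Qed.

(** A discrete intermediate value argument: sliding a window by one changes its number of letters 3
    by at most one, so this number cannot jump over 2. *)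
Lemma windows_same_sign g q :
  (forall t, (t < q)%N -> ups g (t + 5) <> (ups g t + 2)%N) ->
  (forall t, (t < q)%N -> (ups g (t + 5) < ups g t + 2)%N) \/
  (forall t, (t < q)%N -> (ups g (t + 5) > ups g t + 2)%N).
Proof.
elim: q => [|[|q] IHq] ne2; first by left.
  have := ne2 0%N isT; case: (ltnP (ups g (0 + 5)) (ups g 0 + 2)) => [lt0|ge0] ne.
    by left=> -[].
  by right=> -[] // _; lia.
have := ne2 q.+1 (leqnn _); have := upsS g (q + 5); have := upsS g q.
rewrite -addSn => e1 e2 ne.
case: IHq => [t lt_tq|lt2|gt2]; first by apply: ne2; lia.
- left=> t; rewrite ltnS leq_eqVlt => /orP[/eqP->|]; last exact: lt2.
  by have := lt2 q (leqnn _); move: (g _) (g _) e1 e2 => [] []; lia.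
- right=> t; rewrite ltnS leq_eqVlt => /orP[/eqP->|]; last exact: gt2.
  by have := gt2 q (leqnn _); move: (g _) (g _) e1 e2 => [] []; lia.
Qed.

Lemma first_zero_window g n : balanced g (5 * n + 5) ->
  exists2 q, (q <= 5 * n)%N & ups g (q + 5) = (ups g q + 2)%N /\
    forall t, (t < q)%N -> ups g (t + 5) <> (ups g t + 2)%N.
Proof.
move=> gb; have ex_z : exists q, (q <= 5 * n)%N && (ups g (q + 5) == ups g q + 2)%N.
  suff /hasP[q] : has (fun q => ups g (q + 5) == (ups g q + 2)%N)
      (iota 0 (5 * n).+1).
    by rewrite mem_iota => le_q zq; exists q; apply/andP; split=> //; lia.
  apply/negPn/negP => /hasPn nz; have ne t : (t < (5 * n).+1)%N ->
      ups g (t + 5) <> (ups g t + 2)%N.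
    by move=> lt_t; apply/eqP/nz; rewrite mem_iota.
  move: gb; rewrite /balanced -mulnSr => gb.
  (* The word splits into [n.+1] consecutive windows; if all err on the same side, the total cannot
     be zero. *)
  case: (windows_same_sign ne) => [/ups_windows_lt|/ups_windows_gt];
    by move=> /(_ n.+1 0%N); rewrite add0n ups0; lia.
case: (ex_minnP ex_z) => q /andP[le_q /eqP zq] qmin; exists q => //.
split=> // t lt_tq /eqP zt; have := qmin t; rewrite zt andbT; lia.
Qed.

(** The 5-periodic extension of [g] on the window from [q] to [q + 4]. The term [4 * q] stands for
    [- q] modulo 5, which makes the index congruent to [t]. *)
Definition window_pattern (g : nat -> bool) (q t : nat) : bool :=
  g (q + (t + 4 * q) %% 5)%N.

Lemma window_patternE g q t :
  (q <= t)%N -> (t < q + 5)%N -> g t = window_pattern g q t.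
Proof. by move=> le_qt lt_t5; rewrite /window_pattern; congr g; lia. Qed.

Lemma window_patternP g q :
  ups g (q + 5) = (ups g q + 2)%N -> pattern (window_pattern g q).
Proof.
move=> e2; set P := window_pattern g q.
have Pper t : P (t + 5)%N = P t by rewrite /P /window_pattern; congr g; lia.
have := excess_loop (leqnn 5) (@window_patternE g q); rewrite -/P /excess.
by rewrite (ups_periodic _ Pper) => e5; split=> //; lia.
Qed.

Lemma loop_at_exists g n : balanced g (5 * n + 5) -> exit_sorted g (5 * n + 5) ->
  exists P q, [/\ pattern P, (q <= 5 * n)%N & loop_at g P (5 * n + 5) q].
Proof.
move=> gb gs; have [q le_qN [e2 ne2]] := first_zero_window gb.
pose P := window_pattern g q; have Ppat : pattern P := window_patternP e2.
have gP := @window_patternE g q.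
have after := excess_after_loop Ppat gs gP.
have inwin t : (t < q)%N -> exists2 k, (0 < k)%N & (t + 5 * k < q + 5)%N /\
    excess g P (t + 5 * k) = excess g P q.
  (* The ceiling of [(q - t) / 5]: the fewest periods that bring [t] into the loop. *)
  move=> lt_tq; exists ((q - t + 4) %/ 5)%N; first lia.
  split; first lia.
  set s := (t + _)%N; have -> : s = (q + (s - q))%N by rewrite /s; lia.
  by apply: excess_loop => //; rewrite /s; lia.
have before t : (t < q)%N -> excess g P q < excess g P t.
  case: (windows_same_sign ne2) => [/ups_windows_lt lt2|/ups_windows_gt gt2] lt_tq.
    have [k k_gt0 [lt_kq <-]] := inwin t lt_tq.
    by have := lt2 k t lt_kq; rewrite /excess (ups_patternM _ _ Ppat); lia.
  (* If all windows before [q] had too many letters 3, the excess would rise from 0 to a positive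
     value at the loop and stay at least that high, but balance makes it 0 at the end. *)
  have [k k_gt0 [lt_kq]] := inwin 0%N (leq_ltn_trans (leq0n t) lt_tq).
  have := gt2 k 0%N lt_kq; have := after (5 * n + 5)%N ltac:(lia) (leqnn _).
  move: gb; rewrite /balanced /excess.
  have -> : (5 * n + 5 = 0 + 5 * n.+1)%N by lia.
  by rewrite !(ups_patternM _ _ Ppat) !ups0; lia.
exists P, q; split=> //; split=> //; split; first lia.
  exact: before.
move=> t le_tN; case: (leqP q t) => [le_qt|/before /ltW] //.
exact: after.
Qed.

(** * Dependence on initial segments, and the choice of the first minimum *)

Lemma eq_balanced f g N :
  (forall t, (t < N)%N -> f t = g t) -> balanced f N -> balanced g N.
Proof. by move=> fg; rewrite /balanced (eq_ups fg). Qed.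

Lemma eq_exit_sorted f g N :
  (forall t, (t < N)%N -> f t = g t) -> exit_sorted f N -> exit_sorted g N.
Proof.
move=> fg fs i j lt_ij lt_jN; have lt_iN := ltn_trans lt_ij lt_jN.
rewrite -!fg //; have e t : (t < N)%N -> ups g t = ups f t.
  by move=> lt_tN; apply: eq_ups => s lt_st; rewrite fg //; lia.
by rewrite !e //; apply: fs.
Qed.

Lemma eq_excess f g P Q N t : (forall s, (s < N)%N -> f s = g s) -> P =1 Q ->
  (t <= N)%N -> excess f P t = excess g Q t.
Proof.
move=> fg PQ le_tN; rewrite /excess; congr (_%:Z - _%:Z); apply: eq_ups => s lt_st.
  by apply: fg; lia.
exact: PQ.
Qed.

Lemma eq_first_min f g P Q N p : (forall t, (t < N)%N -> f t = g t) -> P =1 Q ->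
  first_min f P N p -> first_min g Q N p.
Proof.
move=> fg PQ [le_pN ltp lep].
have e t : (t <= N)%N -> excess g Q t = excess f P t.
  by move=> le_tN; rewrite (eq_excess fg PQ).
split=> // t lt_t; first by rewrite !e ?ltp //; lia.
by rewrite !e ?lep.
Qed.

Lemma first_min_uniq f P N p q : first_min f P N p -> first_min f P N q -> p = q.
Proof.
case=> le_pN ltp lep [le_qN ltq leq_q]; case: (ltngtP p q) => // [/ltq|/ltp].
  by rewrite ltNge lep.
by rewrite ltNge leq_q.
Qed.

Definition first_argmin (f P : nat -> bool) (N : nat) : nat :=
  find (fun p => all (fun t => excess f P p <= excess f P t) (iota 0 N.+1))
    (iota 0 N.+1).

Lemma first_argminP f P N : first_min f P N (first_argmin f P N).
Proof.
rewrite /first_argmin; set a := fun p => _.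
have : has a (iota 0 N.+1).
  have [i _ imin] := @arg_minP _ _ _ (@ord0 N) xpredT (fun i => excess f P i) isT.
  apply/hasP; exists (i : nat); first by rewrite mem_iota ltn_ord.
  apply/allP => t; rewrite mem_iota => lt_t; exact: (imin (Ordinal lt_t)).
move=> has_a; have lt_p : (find a (iota 0 N.+1) < N.+1)%N.
  by have := has_a; rewrite has_find size_iota.
have := nth_find 0%N has_a; rewrite nth_iota // add0n => /allP lep.
have le_p t : (t <= N)%N ->
    excess f P (find a (iota 0 N.+1)) <= excess f P t.
  by move=> le_t; apply: lep; rewrite mem_iota.
split=> // t lt_t; have := before_find 0%N lt_t.
rewrite nth_iota ?add0n; last exact: ltn_trans lt_p.
move/negbT/allPn => [s]; rewrite mem_iota -ltNge => le_s.
by apply: le_lt_trans; apply: le_p.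
Qed.

(** * Finite lists of bit words and patterns *)

Fixpoint bitwords (k : nat) : seq (seq bool) :=
  if k is k'.+1 then [seq b :: s | b <- [:: true; false], s <- bitwords k']
  else [:: [::]].

Lemma mem_bitwords k s : (s \in bitwords k) = (size s == k).
Proof.
elim: k s => [|k IHk] [|b s] //.
  by apply/negP => /allpairsP[[? ?] []].
rewrite eqSS -IHk; apply/allpairsP/idP => [[[b' s'] [_ ? []]] _ -> //|s_in].
by exists (b, s); split=> //; case: b.
Qed.

Definition patterns : seq (seq bool) := [seq s <- bitwords 5 | count id s == 2%N].

Definition cyclic (s : seq bool) (t : nat) : bool := nth false s (t %% 5).

Lemma mem_patterns s : s \in patterns -> size s = 5%N /\ pattern (cyclic s).
Proof.
rewrite mem_filter mem_bitwords => /andP[/eqP c2 /eqP s5]; split=> //; split.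
  by move=> t; rewrite /cyclic modnDr.
case: s c2 s5 => [|a [|b [|c [|d [|e [|? ?]]]]]] //= c2 _.
by rewrite !upsS ups0 /cyclic /=; lia.
Qed.

Lemma cyclic_mkseq P : pattern P -> cyclic (mkseq P 5) =1 P.
Proof.
move=> Ppat t; rewrite /cyclic nth_mkseq ?ltn_pmod //.
by apply: period_modn; rewrite ?modn_mod.
Qed.

Lemma mkseq_patterns P : pattern P -> mkseq P 5 \in patterns.
Proof.
move=> [_ P2]; rewrite mem_filter mem_bitwords size_mkseq eqxx andbT.
by move: P2; rewrite !upsS ups0 /=; lia.
Qed.

(** * The bijection between (word, pattern) pairs and extended words *)

Definition valid (n : nat) (v : seq bool) : Prop :=
  [/\ size v = (5 * n)%N, balanced (nth false v) (5 * n) &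
      exit_sorted (nth false v) (5 * n)].

Definition extend (n : nat) (v s : seq bool) : seq bool :=
  let f := nth false v in let P := cyclic s in
  mkseq (insert (first_argmin f P (5 * n)) P f) (5 * n + 5).

Lemma nth_extend n v s t : (t < 5 * n + 5)%N ->
  insert (first_argmin (nth false v) (cyclic s) (5 * n)) (cyclic s) (nth false v) t
  = nth false (extend n v s) t.
Proof. by move=> lt_t; rewrite nth_mkseq. Qed.

Lemma valid_extend n v s : valid n v -> s \in patterns -> valid n.+1 (extend n v s).
Proof.
case=> sv vb vs /mem_patterns[_ Ppat].
have pmin := first_argminP (nth false v) (cyclic s) (5 * n).
have [le_pN _ _] := pmin; rewrite /valid mulnSr; split.
- by rewrite size_mkseq.
- by apply: eq_balanced (@nth_extend n v s) _; apply/balanced_insert.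
- by apply: eq_exit_sorted (@nth_extend n v s) _; apply: exit_sorted_insert.
Qed.

Lemma extend_loop_at n v s : s \in patterns ->
  loop_at (nth false (extend n v s)) (cyclic s) (5 * n + 5)
    (first_argmin (nth false v) (cyclic s) (5 * n)).
Proof.
move=> /mem_patterns[_ Ppat].
have /(first_min_insert _ _ _ Ppat)[le_pN pmin] :=
  first_argminP (nth false v) (cyclic s) (5 * n).
split; first exact: (eq_first_min (@nth_extend n v s) (fun _ => erefl)) pmin.
move=> t le_pt lt_t5; rewrite -nth_extend ?insert_loop //; lia.
Qed.

Lemma extend_inj n v v' s s' : size v = (5 * n)%N -> size v' = (5 * n)%N ->
  s \in patterns -> s' \in patterns -> extend n v s = extend n v' s' ->
  v = v' /\ s = s'.
Proof.
move=> sv sv' s_in s'_in eqE.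
have [[s5 Ppat] [s'5 P'pat]] := (mem_patterns s_in, mem_patterns s'_in).
have lp := @extend_loop_at n v s s_in; have lq := @extend_loop_at n v' s' s'_in.
have nthE t lt_t : _ = _ :> bool := etrans (@nth_extend n v s t lt_t)
  (etrans (congr1 (nth false ^~ t) eqE) (esym (@nth_extend n v' s' t lt_t))).
rewrite -eqE in lq; have [pq PQ] := loop_at_inj Ppat P'pat lp lq.
split; last first.
  apply: (@eq_from_nth _ false); rewrite s5 ?s'5 // => i lt_i.
  by have := PQ i; rewrite /cyclic modn_small.
apply: (@eq_from_nth _ false); rewrite sv ?sv' // => i lt_i.
(* With the same loop at the same place, each letter is read back at its own time before the loop
   and five later after it. *)
rewrite -pq in nthE; case: (ltnP i (first_argmin (nth false v) (cyclic s) (5 * n))) => ip.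
  by have := nthE i ltac:(lia); rewrite !insert_before.
by have := nthE (i + 5)%N ltac:(lia); rewrite !insert_after.
Qed.

(** The deleted loop has sum 0, so the remaining times keep their heights and letters, and every
    pair of them comes from a pair in [g]. *)
Lemma exit_sorted_remove g P N q : pattern P -> (q <= N)%N ->
  (forall t, (q <= t)%N -> (t < q + 5)%N -> g t = P t) ->
  exit_sorted g (N + 5) -> exit_sorted (remove q g) N.
Proof.
move=> Ppat le_qN gP gs i j lt_ij lt_jN.
have upsE t : ups (insert q P (remove q g)) t = ups g t.
  by apply: eq_ups => s _; apply: insert_remove.
have ub t : (t <= q)%N -> ups g t = ups (remove q g) t.
  by move=> le_t; rewrite -upsE ups_insert_before.
have ua t : (q <= t)%N -> ups g (t + 5) = (ups (remove q g) t + 2)%N.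
  by move=> le_t; rewrite -upsE ups_insert_after.
have rb t : (t < q)%N -> remove q g t = g t by rewrite /remove => ->.
have ra t : (q <= t)%N -> remove q g t = g (t + 5)%N by rewrite /remove ltnNge => ->.
case: (ltnP i q) => iq; case: (ltnP j q) => jq.
- rewrite !rb // -(ub i (ltnW iq)) -(ub j (ltnW jq)) => e.
  by apply: (gs i j) => //; lia.
- rewrite rb // ra // -(ub i (ltnW iq)) => e.
  by apply: (gs i (j + 5)%N); rewrite ?ua; lia.
- by lia.
- rewrite !ra // => e.
  by apply: (gs (i + 5)%N (j + 5)%N); rewrite ?ua; lia.
Qed.

(** Delete the loop given by [loop_at_exists]. Its place is still the first minimum of the shorter
    word, so by uniqueness [extend] reinserts it exactly there. *)
Lemma extend_surj n w : valid n.+1 w ->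
  exists v s, [/\ valid n v, s \in patterns & w = extend n v s].
Proof.
rewrite /valid mulnSr => -[sw wb ws]; set g := nth false w in wb ws.
have [P [q [Ppat le_qN [qmin gP]]]] := loop_at_exists wb ws.
have insE t : insert q P (remove q g) t = g t by apply: insert_remove.
exists (mkseq (remove q g) (5 * n)), (mkseq P 5).
have nthv t : (t < 5 * n)%N -> remove q g t = nth false (mkseq (remove q g) (5 * n)) t.
  by move=> lt_t; rewrite nth_mkseq.
split; last 1 first.
- have fm : first_min (remove q g) P (5 * n) q.
    apply/(first_min_insert _ _ _ Ppat); split=> //.
    by apply: eq_first_min qmin => // t _; rewrite insE.
  have cP : P =1 cyclic (mkseq P 5) by move=> t; rewrite cyclic_mkseq.
  have fmv := eq_first_min nthv cP fm.
  apply: (@eq_from_nth _ false); rewrite sw ?size_mkseq // => t lt_t.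
  rewrite -nth_extend // (first_min_uniq (first_argminP _ _ _) fmv) -/(g t) -insE.
  case: (positionP q t) lt_t => {}t.
  + by move=> lt_tq _; rewrite !insert_before // -nthv //; lia.
  + by move=> le_qt lt_t5 _; rewrite !insert_loop.
  + by move=> le_qt lt_t; rewrite !insert_after // -nthv //; lia.
- split; first by rewrite size_mkseq.
    apply: (eq_balanced nthv); apply/(balanced_insert _ Ppat le_qN).
    by apply: eq_balanced wb => t _; rewrite insE.
  by apply: (eq_exit_sorted nthv); apply: exit_sorted_remove Ppat le_qN gP ws.
- exact: mkseq_patterns.
Qed.

Fixpoint valid_words (n : nat) : seq (seq bool) :=
  if n is n'.+1 then [seq extend n' v s | v <- valid_words n', s <- patterns]
  else [:: [::]].

Lemma valid_wordsP n v : reflect (valid n v) (v \in valid_words n).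
Proof.
elim: n v => [|n IHn] v.
  rewrite inE; apply: (iffP eqP) => [->|[/size0nil]] //.
  by split=> //; rewrite /balanced ups0.
apply: (iffP idP) => [/allpairsP[[u s] [/IHn vu s_in ->]]|].
  exact: valid_extend.
case/extend_surj=> u [s [/IHn vu s_in ->]].
by apply/allpairsP; exists (u, s).
Qed.

Lemma uniq_valid_words n : uniq (valid_words n).
Proof.
elim: n => [//|n IHn]; apply: allpairs_uniq => //.
move=> [u s] [u' s'] /allpairsP[[a b] [/valid_wordsP[sa _ _] b_in [-> ->]]].
move=> /allpairsP[[a' b'] [/valid_wordsP[sa' _ _] b'_in [-> ->]]].
by case/extend_inj=> // -> ->.
Qed.

Lemma size_valid_words n : size (valid_words n) = (10 ^ n)%N.
(* The factor 10 is [size patterns], obtained by evaluation. *)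
Proof. by elim: n => [//|n IHn]; rewrite [LHS]size_allpairs IHn expnSr. Qed.

(** * Translation to words over 3 and -2 *)

Definition is_up (x : letter) : bool := val x == 3.

Definition bits (m : nat) (w : m.-tuple letter) : seq bool := map is_up w.

Lemma wtE m (w : m.-tuple letter) (k : 'I_m) :
  wt w k = 5 * (nth false (bits w) k)%:Z - 2.
Proof.
rewrite (nth_map (tnth w k)) ?size_tuple // -tnth_nth /wt /is_up.
by have : val (tnth w k) \in [:: 3; - 2] := ssvalP _; rewrite !inE => /orP[] /eqP ->.
Qed.

Lemma sum_steps (f : nat -> bool) i j : (i <= j)%N ->
  \sum_(i <= k < j) (5 * (f k)%:Z - 2) =
  5 * ((ups f j)%:Z - (ups f i)%:Z) - 2 * (j%:Z - i%:Z) :> int.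
Proof.
move=> /subnKC <-; elim: (j - i)%N => [|k IHk]; first by rewrite addn0 big_geq; lia.
by rewrite addnS big_nat_recr ?leq_addr //= IHk upsS; lia.
Qed.

Lemma word_sumE m (w : m.-tuple letter) :
  word_sum w = 5 * (ups (nth false (bits w)) m)%:Z - 2 * m%:Z.
Proof.
rewrite /word_sum; under eq_bigr => k _ do rewrite wtE.
rewrite -(big_mkord xpredT (fun k => 5 * (nth false (bits w) k)%:Z - 2 : int)).
by rewrite sum_steps // ups0; lia.
Qed.

Lemma factor_sumE m (w : m.-tuple letter) (i j : 'I_m) : (i <= j)%N ->
  factor_sum w i j =
  5 * ((ups (nth false (bits w)) j.+1)%:Z - (ups (nth false (bits w)) i)%:Z)
    - 2 * (j.+1%:Z - i%:Z).
Proof.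
move=> le_ij; rewrite /factor_sum; under eq_bigr => k _ do rewrite wtE.
rewrite -sum_steps; last lia.
rewrite (@big_nat_widen _ _ _ i j.+1 m) // (@big_nat_widenl _ _ _ i 0) // big_mkord.
by apply: eq_bigl => k /=; rewrite ltnS andbC.
Qed.

(** A zero-sum factor from [i] to [j] means equal heights at times [i] and [j.+1]. Being bad says
    that this height is left by 3 at [i] and by -2 at [j.+1], which is exactly a failure of
    sortedness. *)
Lemma bad_factorP m (w : m.-tuple letter) :
  reflect (exit_sorted (nth false (bits w)) m) (~~ has_bad_factor w).
Proof.
set f := nth false (bits w).
have wt3 k : (wt w k == 3) = f k by rewrite wtE -/f; case: (f k).
have wt2 k : (wt w k == - 2) = ~~ f k by rewrite wtE -/f; case: (f k).
apply: (iffP idP) => [nb i l lt_il lt_lm eq_h fi|fs].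
  apply: contraNT nb => nfl; have lt_im := ltn_trans lt_il lt_lm.
  have lt_jm : (l.-1 < m)%N by lia.
  apply/existsP; exists (Ordinal lt_im); apply/existsP; exists (Ordinal lt_jm).
  apply/existsP; exists (Ordinal lt_lm); rewrite wt3 wt2 /= fi nfl andbT.
  rewrite factor_sumE /=; last lia.
  have -> : l.-1.+1 = l by lia.
  by apply/and3P; split; rewrite -/f; lia.
apply/negP => /existsP[i /existsP[j /existsP[l]]].
case/and5P=> le_ij /eqP lE; rewrite wt3 wt2 factor_sumE // -lE => fi eq0.
apply/negP; rewrite negbK; apply: fs fi => //; rewrite -/f in eq0 *; lia.
Qed.

Definition letter_of (b : bool) : letter :=
  if b then SeqSub (mem_head (3 : int) [:: - 2])
  else @SeqSub _ [:: 3; - 2] (- 2 : int) isT.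

Lemma letter_ofK : cancel letter_of is_up.
Proof. by case. Qed.

Lemma is_upK : cancel is_up letter_of.
Proof.
move=> x; apply: val_inj; rewrite /is_up.
by have : val x \in [:: 3; - 2] := ssvalP x; rewrite !inE => /orP[] /eqP ->.
Qed.

Lemma valid_bits n (w : (5 * n).-tuple letter) :
  reflect (valid n (bits w)) ((word_sum w == 0) && ~~ has_bad_factor w).
Proof.
rewrite word_sumE; apply: (iffP andP) => [[/eqP e /bad_factorP fs]|[_ e fs]].
  by split=> //; [rewrite size_map size_tuple | rewrite /balanced; lia].
by split; [rewrite /balanced in e; lia | apply/bad_factorP].
Qed.

Theorem mainTheorem1 (n : nat) :
  #|[set w : (5 * n).-tuple letter | (word_sum w == 0) && ~~ has_bad_factor w]|
    = (10 ^ n)%N.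
Proof.
rewrite -size_valid_words cardE -(size_map (@bits _)).
apply: perm_size; apply: uniq_perm; last 1 first.
- move=> v; apply/mapP/valid_wordsP => [[w]|vv].
    by rewrite mem_enum inE => /valid_bits vw ->.
  have sv : size (map letter_of v) == (5 * n)%N by rewrite size_map; case: vv => ->.
  have vE : v = bits (Tuple sv) by rewrite /bits /= (mapK letter_ofK).
  by exists (Tuple sv) => //; rewrite mem_enum inE; apply/valid_bits; rewrite -vE.
- rewrite map_inj_uniq ?enum_uniq // => w w'.
  by move=> /(inj_map (can_inj is_upK)) /val_inj.
- exact: uniq_valid_words.
Qed.
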